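(* Let $\overline{\mathbb{P}}(t,q)$ be the generating series, with $t$ marking the half-perimeter and $q$ marking the area, of asymmetric parallelogram polyominoes. Then $$\overline{\mathbb{P}}(t,q)=F_{\ge0}-F_{\ge\langle r^2\rangle}-F_{\ge\langle d_1\rangle}-F_{\ge\langle d_2\rangle}+2F_{\ge\langle d_1,d_2\rangle}$$ $$=\mathbb{P}(1,t,t,q)-R_2(t,t,q)-D_1(t,t,q)-D_2(t,t,q)+2D_{1,2}(t,t,q),$$ where, for a subgroup $H$ of $\mathfrak{D}_2=\{1,r^2,d_1,d_2\}$, $F_{\ge H}$ is the half-perimeter and area generating series of the parallelogram polyominoes that are invariant under all elements of $H$ ($0$ denoting the trivial subgroup); $\mathbb{P}(v,x,y,q)$ is the generating series of all parallelogram polyominoes with $v,x,y,q$ marking the height of the rightmost column, the width, the height and the area; and $R_2(x,y,q)$, $D_1(x,y,q)$, $D_2(x,y,q)$, $D_{1,2}(x,y,q)$ are the generating series of the $r^2$-symmetric, $d_1$-symmetric, $d_2$-symmetric and $\mathfrak{D}_2$-symmetric parallelogram polyominoes respectively, with $x,y,q$ marking the width, the height and the area.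
   Context: A parallelogram polyomino is a finite nonempty connected set of unit cells of the square lattice, considered up to translation, whose intersection with every row and every column of cells is a contiguous block (or empty), and which contains the bottom-left and the top-right cells of its minimal bounding rectangle. Equivalently, with columns numbered $1,\dots,w$ from left to right, column $i$ occupies the rows $b_i,\dots,t_i$ with $b_i\le b_{i+1}\le t_i\le t_{i+1}$ for $1\le i<w$. The half-perimeter is the sum of the width and the height of the minimal bounding rectangle; the area is the number of cells. The group $\mathfrak{D}_2=\{1,r^2,d_1,d_2\}=\langle d_1,d_2\rangle$, consisting of the identity, the rotation $r^2$ by $180^\circ$, and the reflections $d_1$, $d_2$ about lines parallel to the bisector of the second quadrant ($y=-x$) and of the first quadrant ($y=x$) respectively, acts on parallelogram polyominoes. A polyomino is $g$-symmetric if it equals, up to translation, its image under $g$, and $\mathfrak{D}_2$-symmetric if it is $g$-symmetric for all $g\in\mathfrak{D}_2$. A parallelogram polyomino is asymmetric if it is not $g$-symmetric for any $g\in\mathfrak{D}_2$ other than the identity. *)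

(* Defs.v *)
From HB Require Import structures.
From mathcomp Require Export all_boot all_order all_algebra all_fingroup finmap.
From mathcomp Require Import zify ring.
From mathcomp Require Export boolp functions.

Set Implicit Arguments.
Unset Strict Implicit.
Unset Printing Implicit Defensive.

Import Order.TTheory GRing.Theory Num.Theory.

(* The group {1, r^2, d_1, d_2}; its law is the composition of the isometries
   [act_cell] below, see [act_cellM]. *)

Inductive dih2 := id2 | r2 | d1 | d2.

Definition dih2_code (g : dih2) : bool * bool :=
  match g with
  | id2 => (false, false) | r2 => (true, true)
  | d1 => (true, false) | d2 => (false, true)
  end.

Definition dih2_decode (c : bool * bool) : dih2 :=
  match c with
  | (false, false) => id2 | (true, true) => r2
  | (true, false) => d1 | (false, true) => d2
  end.

Lemma dih2_codeK : cancel dih2_code dih2_decode.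
Proof. by case. Qed.

HB.instance Definition _ := Finite.copy dih2 (can_type dih2_codeK).

Definition dih2_mul (g h : dih2) : dih2 :=
  match g, h with
  | id2, k | k, id2 => k
  | r2, r2 | d1, d1 | d2, d2 => id2
  | d1, d2 | d2, d1 => r2
  | r2, d1 | d1, r2 => d2
  | r2, d2 | d2, r2 => d1
  end.

Lemma dih2_mulA : associative dih2_mul.
Proof. by case=> [] [] []. Qed.

Lemma dih2_mul1 : left_id id2 dih2_mul.
Proof. by case. Qed.

Lemma dih2_mulV : left_inverse id2 id dih2_mul.
Proof. by case. Qed.

HB.instance Definition _ :=
  Finite_isGroup.Build dih2 dih2_mulA dih2_mul1 dih2_mulV.

Lemma dih2_generated : <<[set d1; d2]>>%g = [set: dih2]%g.
Proof.
apply/setP=> g; rewrite in_setT.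
have h1 : d1 \in <<[set d1; d2]>>%g by rewrite mem_gen // !inE eqxx.
have h2 : d2 \in <<[set d1; d2]>>%g by rewrite mem_gen // !inE eqxx orbT.
case: g => //; first exact: (group1 <<[set d1; d2]>>%G).
exact: (groupM h1 h2).
Qed.

Local Open Scope fset_scope.
Local Open Scope ring_scope.

(* (x, y) is the unit cell of column x and row y. *)
Definition cell : Type := (int * int)%type.

(* Isometries are taken up to translation: here the lines of reflection and
   the centre of rotation pass through the centre of the cell (0, 0). *)
Definition act_cell (g : dih2) (c : cell) : cell :=
  match g with
  | id2 => c
  | r2 => (- c.1, - c.2)
  | d1 => (- c.2, - c.1)
  | d2 => (c.2, c.1)
  end.

Lemma act_cellM (g h : dih2) (c : cell) :
  act_cell (g * h)%g c = act_cell g (act_cell h c).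
Proof. by case: g h c => [] [] [x y]; rewrite /act_cell /= ?opprK. Qed.

Definition translate (v : cell) (A : {fset cell}) : {fset cell} :=
  [fset ((c.1 + v.1, c.2 + v.2) : cell) | c in A].

Definition act (g : dih2) (A : {fset cell}) : {fset cell} :=
  [fset act_cell g c | c in A].

Definition symmetric_under (g : dih2) (A : {fset cell}) : Prop :=
  exists v : cell, act g A = translate v A.

Definition invariant_under (H : {set dih2}) (A : {fset cell}) : Prop :=
  forall g, g \in H -> symmetric_under g A.

Definition asymmetric (A : {fset cell}) : Prop :=
  forall g, g != 1%g -> ~ symmetric_under g A.

Definition adjacent (a b : cell) : bool :=
  `|a.1 - b.1| + `|a.2 - b.2| == 1.

Definition connected (A : {fset cell}) : Prop :=
  forall a b, a \in A -> b \in A ->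
  exists p : seq cell, [/\ path adjacent a p, {subset p <= A} & last a p = b].

Definition row_convex (A : {fset cell}) : Prop :=
  forall x1 x x2 y : int, (x1, y) \in A -> (x2, y) \in A ->
  x1 <= x <= x2 -> (x, y) \in A.

Definition column_convex (A : {fset cell}) : Prop :=
  forall x y1 y y2 : int, (x, y1) \in A -> (x, y2) \in A ->
  y1 <= y <= y2 -> (x, y) \in A.

(* Bounding rectangle of a nonempty A; the value is 0 when A is empty. *)
Definition fset_min (S : {fset int}) : int :=
  \big[Num.min/head 0 S]_(x <- S) x.
Definition fset_max (S : {fset int}) : int :=
  \big[Num.max/head 0 S]_(x <- S) x.

Definition xmin (A : {fset cell}) : int := fset_min [fset c.1 | c in A].
Definition xmax (A : {fset cell}) : int := fset_max [fset c.1 | c in A].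
Definition ymin (A : {fset cell}) : int := fset_min [fset c.2 | c in A].
Definition ymax (A : {fset cell}) : int := fset_max [fset c.2 | c in A].

Definition width (A : {fset cell}) : nat := `|xmax A - xmin A|%N.+1.
Definition height (A : {fset cell}) : nat := `|ymax A - ymin A|%N.+1.
Definition half_perimeter (A : {fset cell}) : nat := (width A + height A)%N.
Definition area (A : {fset cell}) : nat := #|` A|.
Definition last_column_height (A : {fset cell}) : nat :=
  #|` [fset c in A | c.1 == xmax A]|.

Definition parallelogram (A : {fset cell}) : Prop :=
  [/\ A != fset0, connected A, row_convex A /\ column_convex A,
      (xmin A, ymin A) \in A & (xmax A, ymax A) \in A].

(* Polyominoes up to translation are represented by the unique translate whose
   bounding rectangle has its bottom-left cell at (0, 0),
   see [half_perimeter_classP]. *)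
Definition normalized (A : {fset cell}) : bool :=
  (xmin A == 0) && (ymin A == 0).

Definition box (n : nat) : {fset cell} :=
  [fset ((Posz i, Posz j) : cell) | i in iota 0 n, j in iota 0 n].

(* The box loses nothing, see [mem_parallelograms]. *)
Definition parallelograms (n : nat) : {fset {fset cell}} :=
  [fset A in fpowerset (box n) |
    [&& `[< parallelogram A >], normalized A & half_perimeter A == n]].

Lemma fset_min_mem (S : {fset int}) : S != fset0 -> fset_min S \in S.
Proof.
case/fset0Pn=> y yS; rewrite /fset_min big_seq.
apply: (big_ind (fun z => z \in S)) => [|a b ha hb|i //]; last by rewrite /Num.min; case: ifP.
have {}yS : y \in enum_fset S := yS; suff: head 0 S \in enum_fset S by [].
by move: yS; case: (enum_fset S) => //= x s _; exact: mem_head.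
Qed.

Lemma fset_min_le (S : {fset int}) (x : int) : x \in S -> fset_min S <= x.
Proof. by move=> xS; apply: ge_bigmin_seq. Qed.

Lemma fset_max_mem (S : {fset int}) : S != fset0 -> fset_max S \in S.
Proof.
case/fset0Pn=> y yS; rewrite /fset_max big_seq.
apply: (big_ind (fun z => z \in S)) => [|a b ha hb|i //]; last by rewrite /Num.max; case: ifP.
have {}yS : y \in enum_fset S := yS; suff: head 0 S \in enum_fset S by [].
by move: yS; case: (enum_fset S) => //= x s _; exact: mem_head.
Qed.

Lemma fset_max_ge (S : {fset int}) (x : int) : x \in S -> x <= fset_max S.
Proof. by move=> xS; apply: (@le_bigmax_seq _ _ _ _ _ x xpredT id). Qed.

Lemma bounding (A : {fset cell}) (c : cell) : c \in A ->
  (xmin A <= c.1 <= xmax A) && (ymin A <= c.2 <= ymax A).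
Proof.
by move=> cA; rewrite !fset_min_le ?fset_max_ge //; exact: in_imfset.
Qed.

Lemma mem_parallelograms (n : nat) (A : {fset cell}) :
  (A \in parallelograms n) =
  [&& `[< parallelogram A >], normalized A & half_perimeter A == n].
Proof.
rewrite !inE /=; apply/andb_idl => /and3P[_ /andP[/eqP x0 /eqP y0] /eqP <-].
rewrite fpowersetE; apply/fsubsetP => -[x y] /bounding /=.
rewrite /half_perimeter /width /height x0 y0 !subr0.
case: x => // i; case: y => // j; rewrite ?andbF // => /and3P[hi _ hj].
have lt_iota (k l : nat) (z : int) : (k%:Z <= z) -> k \in iota 0 (`|z|.+1 + l)%N.
  by rewrite mem_iota; case: z => u //; rewrite lez_nat => ku /=; lia.
apply/imfset2P; exists i; first by case/andP: hi => _ /lt_iota; exact.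
by exists j => //; rewrite [(_ + _)%N]addnC; exact: lt_iota.
Qed.

Lemma mem_translate (v : cell) (A : {fset cell}) (c : cell) :
  (c \in translate v A) = ((c.1 - v.1, c.2 - v.2) \in A).
Proof.
apply/imfsetP/idP => [[d dA ->] /=|cA]; first by rewrite !addrK -surjective_pairing.
by eexists; first exact: cA; rewrite /= !subrK -surjective_pairing.
Qed.

Lemma bounding_attained (A : {fset cell}) : A != fset0 ->
  [/\ exists2 c, c \in A & xmin A = c.1, exists2 c, c \in A & xmax A = c.1,
      exists2 c, c \in A & ymin A = c.2 & exists2 c, c \in A & ymax A = c.2].
Proof.
case/fset0Pn => a aA.
have n0 (f : cell -> int) : [fset f c | c in A] != fset0.
  by apply/fset0Pn; exists (f a); exact: in_imfset.
split.
- by have /imfsetP := fset_min_mem (n0 fst).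
- by have /imfsetP := fset_max_mem (n0 fst).
- by have /imfsetP := fset_min_mem (n0 snd).
- by have /imfsetP := fset_max_mem (n0 snd).
Qed.

Lemma bounding_translate (v : cell) (A : {fset cell}) : A != fset0 ->
  [/\ xmin (translate v A) = xmin A + v.1, xmax (translate v A) = xmax A + v.1,
      ymin (translate v A) = ymin A + v.2 & ymax (translate v A) = ymax A + v.2].
Proof.
move=> A0.
have tA c : c \in A -> (c.1 + v.1, c.2 + v.2) \in translate v A.
  by move=> cA; rewrite mem_translate /= !addrK -surjective_pairing.
have tA0 : translate v A != fset0.
  by case/fset0Pn: A0 => a /tA ta; apply/fset0Pn; eexists; exact: ta.
have [[[x1 y1] h1 e1] [[x2 y2] h2 e2] [[x3 y3] h3 e3] [[x4 y4] h4 e4]] :=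
  bounding_attained A0.
have [[[z1 w1] k1 f1] [[z2 w2] k2 f2] [[z3 w3] k3 f3] [[z4 w4] k4 f4]] :=
  bounding_attained tA0.
move: (bounding (tA _ h1)) (bounding (tA _ h2)) => /= /andP[g1 _] /andP[g2 _].
move: (bounding (tA _ h3)) (bounding (tA _ h4)) => /= /andP[_ g3] /andP[_ g4].
rewrite mem_translate in k1; rewrite mem_translate in k2.
rewrite mem_translate in k3; rewrite mem_translate in k4.
move: (bounding k1) (bounding k2) => /= /andP[i1 _] /andP[i2 _].
move: (bounding k3) (bounding k4) => /= /andP[_ i3] /andP[_ i4].
by move: e1 e2 e3 e4 f1 f2 f3 f4 => /=; split; lia.
Qed.

Lemma parallelogram_translate (v : cell) (A : {fset cell}) :
  parallelogram A -> parallelogram (translate v A).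
Proof.
case=> A0 cA [rA kA] blA trA.
have [ex eX ey eY] := bounding_translate v A0; split.
- case/fset0Pn: A0 => a aA; apply/fset0Pn; exists (a.1 + v.1, a.2 + v.2).
  by rewrite mem_translate /= !addrK -surjective_pairing.
- move=> a b; rewrite !mem_translate => aA bA.
  have [p [pp pA pl]] := cA _ _ aA bA.
  pose f (c : cell) : cell := (c.1 + v.1, c.2 + v.2).
  have fK (c : cell) : f (c.1 - v.1, c.2 - v.2) = c.
    by rewrite /f /= !subrK -surjective_pairing.
  exists (map f p); split.
  + rewrite -[a]fK path_map; apply: sub_path pp => c d.
    have e (x y z : int) : x + z - (y + z) = x - y by ring.
    by rewrite /adjacent /f /= !e.
  + move=> _ /mapP[c /pA cA' ->].
    by rewrite mem_translate /= !addrK -surjective_pairing.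
  + by rewrite -[a]fK last_map pl fK.
- split.
  + move=> x1 x x2 y; rewrite !mem_translate /= => h1 h2 /andP[h h'].
    by apply: rA h1 h2 _; rewrite !lerD2r h.
  + move=> x y1 y y2; rewrite !mem_translate /= => h1 h2 /andP[h h'].
    by apply: kA h1 h2 _; rewrite !lerD2r h.
- by rewrite ex ey mem_translate /= !addrK.
- by rewrite eX eY mem_translate /= !addrK.
Qed.

Lemma half_perimeter_classP (A : {fset cell}) : parallelogram A ->
  exists! B, B \in parallelograms (half_perimeter A) /\
             exists v, B = translate v A.
Proof.
move=> pA; have A0 : A != fset0 by case: pA.
exists (translate (- xmin A, - ymin A) A); split.
- have [ex eX ey eY] := bounding_translate (- xmin A, - ymin A) A0.
  split; last by exists (- xmin A, - ymin A).
  rewrite mem_parallelograms (asboolT (parallelogram_translate _ pA)) /=.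
  rewrite /normalized /half_perimeter /width /height ex eX ey eY /=.
  by rewrite !subrr !subr0 !eqxx.
- move=> B [hB [v eB]]; move: hB; rewrite mem_parallelograms eB.
  have [ex eX ey eY] := bounding_translate v A0.
  case/and3P=> _ /andP[]; rewrite ex ey => /eqP vx /eqP vy _.
  case: v vx vy {eB ex eX ey eY} => a b /= vx vy.
  by rewrite -[xmin A](addrK a) vx -[ymin A](addrK b) vy !sub0r !opprK.
Qed.

(* Formal power series, given by their coefficients: [f n m] is the coefficient
   of t^n q^m, and [f i j m] that of x^i y^j q^m.  Sums, differences and
   multiples are those of the pointwise Z-module structure of functions. *)
Definition fps2 (R : Type) : Type := nat -> nat -> R.
Definition fps3 (R : Type) : Type := nat -> nat -> nat -> R.

(* f(x, y, q) |-> f(t, t, q) *)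
Definition subst_ttq (R : nmodType) (f : fps3 R) : fps2 R :=
  fun n m => \sum_(i < n.+1) f i (n - i)%N m.

Definition gs_tq (C : {fset cell} -> Prop) : fps2 int := fun n m =>
  \sum_(A <- parallelograms n | `[< C A >] && (area A == m)) 1.

Definition gs_xyq (C : {fset cell} -> Prop) : fps3 int := fun i j m =>
  \sum_(A <- parallelograms (i + j) |
        [&& `[< C A >], width A == i, height A == j & area A == m]) 1.

(* P(v, x, y, q), as an element of Z[v][[x, y, q]]: only finitely many powers
   of v occur in each coefficient, so that v can be specialized. *)
Definition Pvxyq : fps3 {poly int} := fun i j m =>
  \sum_(A <- parallelograms (i + j) |
        [&& width A == i, height A == j & area A == m])
    'X^(last_column_height A).

Definition subst_v (R : nzRingType) (v : R) (f : fps3 {poly R}) : fps3 R :=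
  fun i j m => (f i j m).[v].

Definition F_ge (H : {group dih2}) : fps2 int := gs_tq (invariant_under H).
Definition P_asym : fps2 int := gs_tq asymmetric.
Definition R2 : fps3 int := gs_xyq (symmetric_under r2).
Definition D1 : fps3 int := gs_xyq (symmetric_under d1).
Definition D2 : fps3 int := gs_xyq (symmetric_under d2).
Definition D12 : fps3 int := gs_xyq (fun A => forall g, symmetric_under g A).

(* Main.v *)
Require Import Defs.

Import GRing.Theory.
Local Open Scope ring_scope.

(** A parallelogram polyomino [A] is counted according to its stabilizer, the
    set of [g] such that [A] is [g]-symmetric.  Isometries normalize the translations
    ([act_translate]), so this set is a subgroup of the group of four elements
    ([stab_group_set]), and [A] is invariant under a subgroup [H] exactly when
    [H] is contained in the stabilizer.  The first equality is then Moebius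
    inversion on the lattice of subgroups, whose Moebius function takes the
    values 1, -1, -1, -1, 2 on the trivial subgroup, the three subgroups of
    order two and the whole group: the alternating sum of the indicators of
    [H \subset stab A] is the indicator of a trivial stabilizer
    ([moebius_stab]).  It can be summed polyomino by polyomino, since each
    coefficient is a finite sum over the same index set.

    For the second equality, every polyomino of half-perimeter [n] has exactly
    one width [i] and then height [n - i], so setting [x = y = t] in a series
    counting by width and height regroups the polyominoes of half-perimeter [n]
    without loss or repetition ([sum_by_width]); setting [v = 1] forgets the
    height of the last column. *)

Lemma act_id (A : {fset cell}) : act id2 A = A.
Proof. by apply/fsetP => c; apply/imfsetP/idP => [[d dA ->] //|cA]; exists c. Qed.

Lemma act_mul (g h : dih2) (A : {fset cell}) : act (g * h)%g A = act g (act h A).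
Proof.
apply/fsetP => c; apply/imfsetP/imfsetP => [[d dA ->]|[e /imfsetP[d dA ->] ->]].
  by exists (act_cell h d); rewrite ?act_cellM //; exact: in_imfset.
by exists d; rewrite ?act_cellM.
Qed.

Lemma translate0 (A : {fset cell}) : translate (0, 0) A = A.
Proof. by apply/fsetP => -[x y]; rewrite mem_translate /= !subr0. Qed.

Lemma translateD (v w : cell) (A : {fset cell}) :
  translate v (translate w A) = translate (v.1 + w.1, v.2 + w.2) A.
Proof. by apply/fsetP => c; rewrite !mem_translate /= !opprD !addrA. Qed.

(** The cell action is linear, so it normalizes the translations; this is
    what makes symmetry up to translation stable under composition. *)
Lemma act_translate (g : dih2) (v : cell) (A : {fset cell}) :
  act g (translate v A) = translate (act_cell g v) (act g A).
Proof.
have lin (c : cell) : act_cell g (c.1 + v.1, c.2 + v.2) =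
    ((act_cell g c).1 + (act_cell g v).1, (act_cell g c).2 + (act_cell g v).2).
  by case: g; rewrite /= ?opprD.
apply/fsetP => c; apply/imfsetP/imfsetP.
  case=> _ /imfsetP[d dA ->] ->.
  by exists (act_cell g d); rewrite ?lin //; exact: in_imfset.
case=> _ /imfsetP[d dA ->] ->.
by exists (d.1 + v.1, d.2 + v.2); rewrite ?lin //; apply/imfsetP; exists d.
Qed.

Lemma symmetric_under1 (A : {fset cell}) : symmetric_under 1%g A.
Proof. by exists (0, 0); rewrite translate0 act_id. Qed.

Lemma symmetric_underM (g h : dih2) (A : {fset cell}) :
  symmetric_under g A -> symmetric_under h A -> symmetric_under (g * h)%g A.
Proof.
move=> [v gA] [w hA].
by eexists; rewrite act_mul hA act_translate gA translateD.
Qed.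

Definition stab (A : {fset cell}) : {set dih2} :=
  [set g | `[< symmetric_under g A >]].

Lemma stabP (g : dih2) (A : {fset cell}) :
  reflect (symmetric_under g A) (g \in stab A).
Proof. by rewrite inE; exact: asboolP. Qed.

Lemma stab_group_set (A : {fset cell}) : group_set (stab A).
Proof.
apply/group_setP; split; first exact/stabP/symmetric_under1.
by move=> g h /stabP gA /stabP hA; exact/stabP/symmetric_underM.
Qed.

Canonical stab_group (A : {fset cell}) := Group (stab_group_set A).

Lemma invariant_underE (H : {set dih2}) (A : {fset cell}) :
  `[< invariant_under H A >] = (H \subset stab A).
Proof.
apply/asboolP/subsetP => [inv g gH|sub g gH]; first exact/stabP/inv.
exact/stabP/sub.
Qed.

Lemma asymmetricE (A : {fset cell}) :
  `[< asymmetric A >] = [&& r2 \notin stab A, d1 \notin stab A & d2 \notin stab A].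
Proof.
apply/asboolP/and3P => [asym|[/stabP nr /stabP n1 /stabP n2]].
  by split; apply/stabP/asym.
by case.
Qed.

(** Two of the three involutions generate the third, so the number of
    involutions in the stabilizer is 0, 1 or 3; the sum is then 1, 1 - 1 = 0
    or 1 - 3 + 2 = 0. *)
Lemma moebius_stab (A : {fset cell}) :
  `[< asymmetric A >]%:R =
  `[< invariant_under 1%G A >]%:R - `[< invariant_under <[r2]>%G A >]%:R
  - `[< invariant_under <[d1]>%G A >]%:R - `[< invariant_under <[d2]>%G A >]%:R
  + `[< invariant_under <<[set d1; d2]>>%G A >]%:R *+ 2 :> int.
Proof.
rewrite !invariant_underE asymmetricE /= sub1G !cycle_subG gen_subG subUset !sub1set.
have h12 : d1 \in stab A -> d2 \in stab A -> r2 \in stab A.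
  exact: (@groupM _ (stab_group A) d1 d2).
have hr1 : r2 \in stab A -> d1 \in stab A -> d2 \in stab A.
  exact: (@groupM _ (stab_group A) r2 d1).
have hr2 : r2 \in stab A -> d2 \in stab A -> d1 \in stab A.
  exact: (@groupM _ (stab_group A) r2 d2).
move: h12 hr1 hr2.
case: (r2 \in stab A); case: (d1 \in stab A); case: (d2 \in stab A) => //=.
- by move=> _ /(_ isT isT).
- by move=> _ _ /(_ isT isT).
- by move=> /(_ isT isT).
Qed.

Lemma gs_tqE (C : {fset cell} -> Prop) (n m : nat) :
  gs_tq C n m = \sum_(A <- parallelograms n | area A == m) `[< C A >]%:R.
Proof.
rewrite /gs_tq big_mkcondl; apply: eq_bigr => A _.
by case: `[< C A >].
Qed.

Lemma eq_gs_tq (C C' : {fset cell} -> Prop) :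
  (forall A, `[< C A >] = `[< C' A >]) -> gs_tq C = gs_tq C'.
Proof.
move=> eC; apply/funext => n; apply/funext => m; rewrite !gs_tqE.
by apply: eq_bigr => A _; rewrite eC.
Qed.

(** The truncated subtraction is harmless because the width is at most the
    half-perimeter. *)
Lemma sum_by_width (V : nmodType) (n : nat) (P : pred {fset cell})
    (F : {fset cell} -> V) :
  \sum_(i < n.+1) \sum_(A <- parallelograms (i + (n - i)) |
      [&& width A == i, height A == (n - i)%N & P A]) F A
  = \sum_(A <- parallelograms n | P A) F A.
Proof.
rewrite [RHS]big_seq_cond.
pose w A : 'I_n.+1 := inord (width A).
rewrite (partition_big w xpredT) //=; apply: eq_bigr => i _.
have le_in : (i <= n)%N by rewrite -ltnS.
rewrite subnKC // [LHS]big_seq_cond; apply: eq_bigl => A.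
case: (boolP (A \in parallelograms n)) => //=.
rewrite mem_parallelograms => /and3P[_ _ /eqP hn].
have wA : width A + height A = n by [].
have -> : (w A == i) = (width A == i).
  by rewrite -val_eqE /= inordK // ltnS -wA leq_addr.
rewrite [RHS]andbC; case: eqP => //= wi.
by rewrite -[X in (X - _)%N]wA wi addKn eqxx.
Qed.

Lemma subst_ttq_gs_xyq (C : {fset cell} -> Prop) : subst_ttq (gs_xyq C) = gs_tq C.
Proof.
apply/funext => n; apply/funext => m.
rewrite /subst_ttq /gs_xyq /gs_tq -sum_by_width.
apply: eq_bigr => i _; apply: eq_bigl => A.
by rewrite andbCA; congr (_ && _); rewrite andbCA.
Qed.

Lemma subst_ttq_Pvxyq : subst_ttq (subst_v 1 Pvxyq) = gs_tq (fun=> True).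
Proof.
apply/funext => n; apply/funext => m.
rewrite gs_tqE -sum_by_width /subst_ttq /subst_v /Pvxyq.
apply: eq_bigr => i _; rewrite horner_sum; apply: eq_bigr => A _.
by rewrite hornerXn expr1n asboolT.
Qed.

Lemma F_ge1 : F_ge 1%G = subst_ttq (subst_v 1 Pvxyq).
Proof.
rewrite subst_ttq_Pvxyq; apply: eq_gs_tq => A.
by rewrite invariant_underE sub1G asboolT.
Qed.

Lemma F_ge_cycle (g : dih2) :
  F_ge <[g]>%G = subst_ttq (gs_xyq (symmetric_under g)).
Proof.
rewrite subst_ttq_gs_xyq; apply: eq_gs_tq => A.
by rewrite invariant_underE /= cycle_subG inE.
Qed.

Lemma F_ge_full : F_ge <<[set d1; d2]>>%G = subst_ttq D12.
Proof.
rewrite subst_ttq_gs_xyq; apply: eq_gs_tq => A.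
rewrite invariant_underE /= dih2_generated.
apply/subsetP/asboolP => [sub g|sym g _]; last exact/stabP.
exact/stabP/sub/in_setT.
Qed.

Theorem proposition12 :
  P_asym = F_ge 1%G - F_ge <[r2]>%G - F_ge <[d1]>%G - F_ge <[d2]>%G
           + F_ge <<[set d1; d2]>>%G *+ 2
  /\
  F_ge 1%G - F_ge <[r2]>%G - F_ge <[d1]>%G - F_ge <[d2]>%G
           + F_ge <<[set d1; d2]>>%G *+ 2
  = subst_ttq (subst_v 1 Pvxyq) - subst_ttq R2 - subst_ttq D1 - subst_ttq D2
    + subst_ttq D12 *+ 2.
Proof.
split; last by rewrite F_ge1 !F_ge_cycle F_ge_full.
apply/funext => n; apply/funext => m.
rewrite mulr2n !fctE /F_ge /P_asym !gs_tqE -!sumrB -!big_split /=.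
by apply: eq_bigr => A _; rewrite moebius_stab mulr2n.
Qed.
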